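(* Let $\theta^0,\theta^1,\theta^\infty_1,\theta^\infty_2,\theta^\infty_3\in\mathbb{C}$ with $2\theta^0+2\theta^1+2\theta^\infty_1+\theta^\infty_2+\theta^\infty_3=0$, $\theta^0\neq0$ and $\theta^\infty_1,\theta^\infty_2,\theta^\infty_3$ pairwise distinct. Let $q_1,p_1,q_2,p_2,v$ be holomorphic functions of $t$ and $U$ a holomorphic $2\times2$-matrix function of $t$ on a domain of $\mathbb{C}\setminus\{0\}$, with $v\ne0$ and $\det U\neq0$. Put $$Q=\begin{pmatrix} q_1&1\\-q_2&q_1\end{pmatrix},\quad P=\begin{pmatrix} p_1/2&-p_2\\ p_2q_2-\theta^0-\theta^1-\theta^\infty_1-\theta^\infty_2&p_1/2\end{pmatrix},\quad \Theta=\begin{pmatrix}\theta^\infty_2&0\\0&\theta^\infty_3\end{pmatrix},\quad G=U\oplus\mathrm{diag}(v,1),$$ $$Z=(\theta^\infty_1-\Theta)^{-1}\left[-(P+t)Q(Q-1)+(2\theta^0+\theta^1+2\theta^\infty_1)Q-\theta^0-\theta^1-\theta^\infty_1\right],$$ and in $2\times2$ blocks (scalars meaning multiples of $I=I_2$) $$\hat A_1^{(-1)}=\begin{pmatrix}I\\Q-Z\end{pmatrix}\begin{pmatrix}-t(I-Q)-tZ&-tI\end{pmatrix},\quad \hat A_1^{(0)}=\begin{pmatrix}-(\theta^0+\theta^\infty_1)I+(P+t)Z&P+t\\\theta^0Z-Z(P+t)Z&-Z(P+t)-\Theta\end{pmatrix},$$ $$\hat A_0^{(0)}=\begin{pmatrix}I\\-Z\end{pmatrix}\begin{pmatrix}\theta^0I-(P+t)Z&-tI-P\end{pmatrix}.$$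 Consider the linear systems $$\frac{\partial Y}{\partial x}=AY,\quad A=G^{-1}\left(\frac{\hat A_0^{(0)}}{x}+\frac{\hat A_1^{(-1)}}{(x-1)^2}+\frac{\hat A_1^{(0)}}{x-1}\right)G,\qquad \frac{\partial Y}{\partial t}=BY,\quad B=-\frac1{t(x-1)}\,G^{-1}\hat A_1^{(-1)}G .$$ Then the compatibility condition $\partial_tA-\partial_xB+[A,B]=O$ (for all $x$) is equivalent to the Hamiltonian system $\frac{dq_i}{dt}=\frac{\partial H}{\partial p_i}$, $\frac{dp_i}{dt}=-\frac{\partial H}{\partial q_i}$ $(i=1,2)$ with $$tH=\mathrm{tr}\left[P(P+t)Q(Q-1)+(\theta^0+\theta^1+\theta^\infty_1)P-(\theta^0+\theta^1+2\theta^\infty_1-1)tQ-(2\theta^0+\theta^1+2\theta^\infty_1)PQ\right],$$ together with $t\,\frac{dU}{dt}=MU$, where $$M_{11}=(1-2q_1)\left(\tfrac32p_1+2t\right)+2\left(q_1(q_1-1)p_2-2p_2q_2+\theta^0+\theta^\infty_1-\theta^\infty_3\right),\quad M_{12}=(2q_1-1)p_2-p_1-2t,$$ $$M_{21}=(p_2q_2-\theta^0-\theta^1-\theta^\infty_1-\theta^\infty_2)(1-2q_1)+(p_1+2t)q_2,$$ $$M_{22}=(1-2q_1)\left(\tfrac12p_1+t\right)-2p_2q_2+4\theta^0+3\theta^1+4\theta^\infty_1+2\theta^\infty_2,$$ and $$\frac tv\frac{dv}{dt}=p_1(1-2q_1)-2tq_1-2p_2q_2+2p_2q_1(q_1-1)+t+4\theta^0+3\theta^1+4\theta^\infty_1+2\theta^\infty_2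 .$$
   Context: This is the fifth matrix Painlevé system $H^{\mathrm{Mat}}_{\mathrm{V}}$, attached to linear systems with regular singularities at $x=0,\infty$ and an irregular singularity at $x=1$, of spectral type $(2)(2),22,211$. $H$ is regarded as a function of $q_1,p_1,q_2,p_2,t$ by inserting the displayed matrices. $\oplus$ denotes block-diagonal sum. *)

(* Defs.v *)
From HB Require Import structures.
From mathcomp Require Import all_boot all_order all_algebra.
From mathcomp Require Export complex.
From mathcomp Require Import all_classical all_reals all_analysis.

Set Implicit Arguments.
Unset Strict Implicit.
Unset Printing Implicit Defensive.

Import Order.TTheory GRing.Theory Num.Theory.
Import numFieldNormedType.Exports.

Local Open Scope ring_scope.
Local Open Scope classical_set_scope.

(* Everything below is stated over an arbitrary numFieldType K and is used with
   K := R[i], R : realType.  For a function K -> K, [derivable f t 1] and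
   [derive1 f t] use difference quotients with increments in K; for K = R[i] they
   are complex differentiability and the complex derivative. *)

Definition is_domain (K : numFieldType) (D : set K) : Prop :=
  [/\ open D, connected D & D !=set0].

Definition holomorphic_on (K : numFieldType) (D : set K) (f : K -> K) : Prop :=
  forall t, D t -> derivable f t 1.

Definition mx_holomorphic_on (K : numFieldType) (D : set K) (m n : nat)
    (F : K -> 'M[K]_(m, n)) : Prop :=
  forall i j, holomorphic_on D (fun t => F t i j).

Definition mx_derive1 (K : numFieldType) (m n : nat)
    (F : K -> 'M[K]_(m, n)) (t : K) : 'M[K]_(m, n) :=
  \matrix_(i, j) derive1 (fun s => F s i j) t.

Definition mx2 (K : numFieldType) (a b c d : K) : 'M[K]_2 :=
  \matrix_(i, j) if i == 0 then (if j == 0 then a else b)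
                 else (if j == 0 then c else d).

(* The parameters theta^0, theta^1, theta^oo_1, theta^oo_2, theta^oo_3. *)
Record exponents (K : numFieldType) := Exponents {
  th0 : K; th1 : K; thi1 : K; thi2 : K; thi3 : K }.

Section MatrixPV.
Variables (K : numFieldType) (th : exponents K).

Definition Qmx (q1 q2 : K) : 'M[K]_2 := mx2 q1 1 (- q2) q1.

Definition Pmx (p1 q2 p2 : K) : 'M[K]_2 :=
  mx2 (p1 / 2) (- p2)
      (p2 * q2 - th0 th - th1 th - thi1 th - thi2 th) (p1 / 2).

Definition Thetamx : 'M[K]_2 := mx2 (thi2 th) 0 0 (thi3 th).

Definition Gmx (U : 'M[K]_2) (v : K) : 'M[K]_(2 + 2) :=
  block_mx U 0 0 (mx2 v 0 0 1).

Definition Zmx (q1 p1 q2 p2 t : K) : 'M[K]_2 :=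
  let Q := Qmx q1 q2 in
  let P := Pmx p1 q2 p2 in
  invmx ((thi1 th)%:M - Thetamx) *m
    (- ((P + t%:M) *m Q *m (Q - 1%:M))
     + (2 * th0 th + th1 th + 2 * thi1 th) *: Q
     - (th0 th + th1 th + thi1 th)%:M).

(* Coefficient of (x - 1)^-2. *)
Definition hatA1m1 (q1 p1 q2 p2 t : K) : 'M[K]_(2 + 2) :=
  let Q := Qmx q1 q2 in
  let Z := Zmx q1 p1 q2 p2 t in
  col_mx 1%:M (Q - Z) *m row_mx (- (t *: (1%:M - Q)) - t *: Z) (- t%:M).

(* Coefficient of (x - 1)^-1. *)
Definition hatA10 (q1 p1 q2 p2 t : K) : 'M[K]_(2 + 2) :=
  let Pt := Pmx p1 q2 p2 + t%:M in
  let Z := Zmx q1 p1 q2 p2 t in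
  block_mx (- (th0 th + thi1 th)%:M + Pt *m Z) Pt
           (th0 th *: Z - Z *m Pt *m Z)        (- (Z *m Pt) - Thetamx).

(* Coefficient of x^-1. *)
Definition hatA00 (q1 p1 q2 p2 t : K) : 'M[K]_(2 + 2) :=
  let P := Pmx p1 q2 p2 in
  let Z := Zmx q1 p1 q2 p2 t in
  col_mx 1%:M (- Z) *m row_mx ((th0 th)%:M - (P + t%:M) *m Z) (- t%:M - P).

Definition Amx (q1 p1 q2 p2 v : K) (U : 'M[K]_2) (t x : K) : 'M[K]_(2 + 2) :=
  let G := Gmx U v in
  invmx G *m
    (x^-1 *: hatA00 q1 p1 q2 p2 t
     + ((x - 1) ^+ 2)^-1 *: hatA1m1 q1 p1 q2 p2 t
     + (x - 1)^-1 *: hatA10 q1 p1 q2 p2 t) *m G.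

Definition Bmx (q1 p1 q2 p2 v : K) (U : 'M[K]_2) (t x : K) : 'M[K]_(2 + 2) :=
  let G := Gmx U v in
  - (t * (x - 1))^-1 *: (invmx G *m hatA1m1 q1 p1 q2 p2 t *m G).

Definition Ham (q1 p1 q2 p2 t : K) : K :=
  let Q := Qmx q1 q2 in
  let P := Pmx p1 q2 p2 in
  t^-1 * \tr (P *m (P + t%:M) *m Q *m (Q - 1%:M)
              + (th0 th + th1 th + thi1 th) *: P
              - ((th0 th + th1 th + 2 * thi1 th - 1) * t) *: Q
              - (2 * th0 th + th1 th + 2 * thi1 th) *: (P *m Q)).

Definition hamiltonian_system (q1 p1 q2 p2 : K -> K) (t : K) : Prop :=
  [/\ derive1 q1 t = derive1 (fun y => Ham (q1 t) y (q2 t) (p2 t) t) (p1 t),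
      derive1 p1 t = - derive1 (fun y => Ham y (p1 t) (q2 t) (p2 t) t) (q1 t),
      derive1 q2 t = derive1 (fun y => Ham (q1 t) (p1 t) (q2 t) y t) (p2 t) &
      derive1 p2 t = - derive1 (fun y => Ham (q1 t) (p1 t) y (p2 t) t) (q2 t)].

Definition Mmx (q1 p1 q2 p2 t : K) : 'M[K]_2 :=
  mx2
    ((1 - 2 * q1) * (3 / 2 * p1 + 2 * t)
     + 2 * (q1 * (q1 - 1) * p2 - 2 * p2 * q2 + th0 th + thi1 th - thi3 th))
    ((2 * q1 - 1) * p2 - p1 - 2 * t)
    ((p2 * q2 - th0 th - th1 th - thi1 th - thi2 th) * (1 - 2 * q1)
     + (p1 + 2 * t) * q2)
    ((1 - 2 * q1) * (1 / 2 * p1 + t) - 2 * p2 * q2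
     + 4 * th0 th + 3 * th1 th + 4 * thi1 th + 2 * thi2 th).

(* The value of (t / v) dv/dt. *)
Definition vrate (q1 p1 q2 p2 t : K) : K :=
  p1 * (1 - 2 * q1) - 2 * t * q1 - 2 * p2 * q2 + 2 * p2 * q1 * (q1 - 1) + t
  + 4 * th0 th + 3 * th1 th + 4 * thi1 th + 2 * thi2 th.

Definition U_equation (q1 p1 q2 p2 : K -> K) (U : K -> 'M[K]_2) (t : K) : Prop :=
  t *: mx_derive1 U t = Mmx (q1 t) (p1 t) (q2 t) (p2 t) t *m U t.

Definition v_equation (q1 p1 q2 p2 v : K -> K) (t : K) : Prop :=
  t / v t * derive1 v t = vrate (q1 t) (p1 t) (q2 t) (p2 t) t.

End MatrixPV.

(* d_t A - d_x B + [A, B] = O at the point (t, x); the first argument of A and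
   B is t. *)
Definition compatible_at (K : numFieldType) (n : nat)
    (A B : K -> K -> 'M[K]_n) (t x : K) : Prop :=
  mx_derive1 (fun s => A s x) t - mx_derive1 (B t) x
  + (A t x *m B t x - B t x *m A t x) = 0.

(* Main.v *)
Require Import Defs.
From HB Require Import structures.
From mathcomp Require Import all_boot all_order all_algebra.
From mathcomp Require Import complex.
From mathcomp Require Import all_classical all_reals all_analysis.
From mathcomp Require Import ring.
Import Order.TTheory GRing.Theory Num.Theory.
Import numFieldNormedType.Exports.
Local Open Scope ring_scope.
Local Open Scope complex_scope.
Local Open Scope classical_set_scope.

(** The proof rests on gauge covariance. Let Gamma = G' G^-1; it is block diagonal,
    with blocks C1 = U' U^-1 and C2 = diag(v'/v, 0). Conjugating by G turns the
    compatibility condition into an identity between rational functions of x with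
    poles at 0 and 1, hence into three matrix equations for the coefficients of
    1/x, 1/(x-1)^2 and 1/(x-1) ([compatible_residues]). The residues at 0 and 1 add
    up to a constant block diagonal matrix that commutes with Gamma, so the third
    equation is the opposite of the first.

    Each of the two remaining coefficients is a product of a block column and a
    block row, and its equation is a Lax equation [M' = X M - M X], for the
    coefficient itself at 0 and for its quotient by t at 1; such an equation is
    carried by the two factors separately ([factor_flow]). With P written for
    P + t, and a, b for theta^0 and theta^oo_1, the factors yield ([residue_equations],
    which uses theta^0 <> 0)

      t (C1 - C2) = P - Q P - P Q + a + b - Theta,
      P' = C1 P - P C2 + P Q + Q P - P - a,
      t Q' = t (Q - Q^2) + (a + b - Theta) Q - Q P Q - (b - Theta) Z
             + t (C2 Q - Q C1),
      Z' = Q - Q^2 + C2 Z - Z C1.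

    It remains to compare these with the scalar system ([scalar_equations]). Let
    HQ, HP, H1, H2 collect the amounts by which q_i, p_i, U and v fail to satisfy the
    Hamiltonian system and the equations for U and v. The defects of the four
    equations are linear in them:

      H1 - H2,   HP - H1 P + P H2,   HQ + Q H1 - H2 Q,

    and a similar expression for the last one. Hence the scalar system implies all
    four equations. Conversely, if the defects vanish then H1 = H2 = diag(w, 0), and
    (Q, P) moves only by the infinitesimal conjugation by diag(w, 0); since the upper
    right entry of Q is normalized to 1, the entry (1,2) of HQ + Q H1 - H2 Q is - w,
    so that w = 0 and HQ = HP = 0. *)

Set Implicit Arguments.
Unset Strict Implicit.

(** * Entrywise differentiation of matrix functions *)
Section MatrixCalculus.
Variable K : numFieldType.
Implicit Type t : K.

(** Differentiability is required entry by entry, as in [mx_holomorphic_on]. *)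
Definition mx_is_derive (m n : nat) (F : K -> 'M[K]_(m, n)) t
    (dF : 'M[K]_(m, n)) : Prop :=
  forall i j, is_derive t (1 : K) (fun s => F s i j : K) (dF i j).

Lemma is_derive_ext (f g : K -> K) t (df dg : K) :
  is_derive t (1 : K) f df -> f =1 g -> df = dg -> is_derive t (1 : K) g dg.
Proof. by move=> dft /funext<- <-. Qed.

Lemma is_derive_derive1 (f : K -> K) t (df : K) :
  is_derive t (1 : K) f df -> derive1 f t = df.
Proof. by move=> dft; rewrite derive1E derive_val. Qed.

Lemma derivable_is_derive1 (f : K -> K) t :
  derivable f t (1 : K) -> is_derive t (1 : K) f (derive1 f t).
Proof. by rewrite derive1E => dft; exact: derivableP. Qed.

Lemma is_derive_inv (f : K -> K) t (df : K) :
  is_derive t (1 : K) f df -> f t != 0 ->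
  is_derive t (1 : K) (fun s => (f s)^-1 : K) (- (df / f t ^+ 2)).
Proof.
move=> dft ft0; apply: DeriveDef; first exact: derivableV.
by rewrite deriveV// derive_val /GRing.scale /= mulNr mulrC.
Qed.

Lemma mx_is_derive_derive1 m n (F : K -> 'M[K]_(m, n)) t dF :
  mx_is_derive F t dF -> mx_derive1 F t = dF.
Proof.
by move=> dFt; apply/matrixP => i j; rewrite mxE; exact: is_derive_derive1.
Qed.

Lemma mx_is_derive_ext m n (F : K -> 'M[K]_(m, n)) t dF dF' :
  mx_is_derive F t dF -> dF = dF' -> mx_is_derive F t dF'.
Proof. by move=> + <-. Qed.

Lemma mx_is_derive_near m n (F G : K -> 'M[K]_(m, n)) t dF :
  (\near t, F t = G t) -> mx_is_derive F t dF -> mx_is_derive G t dF.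
Proof.
move=> FG dFt i j; apply: near_eq_is_derive (dFt i j).
by apply: filterS FG => s ->.
Qed.

Lemma mx_is_derive_cst m n (A : 'M[K]_(m, n)) t :
  mx_is_derive (fun=> A) t 0.
Proof. by move=> i j; rewrite mxE; exact: is_derive_cst. Qed.

Lemma mx_is_deriveD m n (F G : K -> 'M[K]_(m, n)) t dF dG :
  mx_is_derive F t dF -> mx_is_derive G t dG ->
  mx_is_derive (fun s => F s + G s) t (dF + dG).
Proof.
move=> dFt dGt i j; apply: is_derive_ext (is_deriveD (dFt i j) (dGt i j)) _ _.
  by move=> s; rewrite mxE.
by rewrite mxE.
Qed.

Lemma mx_is_deriveN m n (F : K -> 'M[K]_(m, n)) t dF :
  mx_is_derive F t dF -> mx_is_derive (fun s => - F s) t (- dF).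
Proof.
move=> dFt i j; apply: is_derive_ext (is_deriveN (dFt i j)) _ _.
  by move=> s; rewrite mxE.
by rewrite mxE.
Qed.

Lemma mx_is_deriveZ m n (a : K -> K) (F : K -> 'M[K]_(m, n)) t da dF :
  is_derive t (1 : K) a da -> mx_is_derive F t dF ->
  mx_is_derive (fun s => a s *: F s) t (da *: F t + a t *: dF).
Proof.
move=> dat dFt i j; apply: is_derive_ext (is_deriveM dat (dFt i j)) _ _.
  by move=> s; rewrite mxE.
by rewrite !mxE addrC; congr (_ + _); rewrite mulrC.
Qed.

Lemma is_derive_bigsum (I : Type) (r : seq I) (P : pred I) (f : I -> K -> K)
    (df : I -> K) t :
  (forall i, is_derive t (1 : K) (f i) (df i)) ->
  is_derive t (1 : K) (fun s => \sum_(i <- r | P i) f i s)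
    (\sum_(i <- r | P i) df i).
Proof.
move=> dft; have -> : (fun s => \sum_(i <- r | P i) f i s) =
    \sum_(i <- r | P i) f i by apply/funext => s; rewrite fct_sumE.
elim/big_ind2 : _ => // [|f1 ? f2 ?]; first exact: is_derive_cst.
exact: is_deriveD.
Qed.

Lemma mx_is_deriveM m n p (F : K -> 'M[K]_(m, n)) (G : K -> 'M[K]_(n, p)) t dF dG :
  mx_is_derive F t dF -> mx_is_derive G t dG ->
  mx_is_derive (fun s => F s *m G s) t (dF *m G t + F t *m dG).
Proof.
move=> dFt dGt i j.
apply: is_derive_ext
  (is_derive_bigsum _ xpredT (fun k => is_deriveM (dFt i k) (dGt k j))) _ _.
  by move=> s; rewrite mxE.
rewrite !mxE -big_split; apply: eq_bigr => k _ /=.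
by rewrite addrC; congr (_ + _); rewrite mulrC.
Qed.

Lemma mx_is_derive_row m n1 n2 (F : K -> 'M[K]_(m, n1)) (G : K -> 'M[K]_(m, n2))
    t dF dG :
  mx_is_derive F t dF -> mx_is_derive G t dG ->
  mx_is_derive (fun s => row_mx (F s) (G s)) t (row_mx dF dG).
Proof.
move=> dFt dGt i j; rewrite -(fintype.splitK j); case: (fintype.split j) => k /=.
  apply: is_derive_ext (dFt i k) _ _ => [s|]; by rewrite row_mxEl.
apply: is_derive_ext (dGt i k) _ _ => [s|]; by rewrite row_mxEr.
Qed.

Lemma mx_is_derive_col m1 m2 n (F : K -> 'M[K]_(m1, n)) (G : K -> 'M[K]_(m2, n))
    t dF dG :
  mx_is_derive F t dF -> mx_is_derive G t dG ->
  mx_is_derive (fun s => col_mx (F s) (G s)) t (col_mx dF dG).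
Proof.
move=> dFt dGt i j; rewrite -(fintype.splitK i); case: (fintype.split i) => k /=.
  apply: is_derive_ext (dFt k j) _ _ => [s|]; by rewrite col_mxEu.
apply: is_derive_ext (dGt k j) _ _ => [s|]; by rewrite col_mxEd.
Qed.

Lemma mx_is_derive_block m1 m2 n1 n2
    (F1 : K -> 'M[K]_(m1, n1)) (F2 : K -> 'M[K]_(m1, n2))
    (F3 : K -> 'M[K]_(m2, n1)) (F4 : K -> 'M[K]_(m2, n2)) t dF1 dF2 dF3 dF4 :
  mx_is_derive F1 t dF1 -> mx_is_derive F2 t dF2 ->
  mx_is_derive F3 t dF3 -> mx_is_derive F4 t dF4 ->
  mx_is_derive (fun s => block_mx (F1 s) (F2 s) (F3 s) (F4 s)) t
    (block_mx dF1 dF2 dF3 dF4).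
Proof.
by move=> *; apply: mx_is_derive_col; apply: mx_is_derive_row.
Qed.

Lemma derivable_bigprod (I : Type) (r : seq I) (P : pred I) (f : I -> K -> K) t :
  (forall i, derivable (f i) t (1 : K)) ->
  derivable (fun s => \prod_(i <- r | P i) f i s) t (1 : K).
Proof.
move=> dft; have -> : (fun s => \prod_(i <- r | P i) f i s) =
    \prod_(i <- r | P i) f i by apply/funext => s; rewrite fct_prodE.
elim/big_ind : _ => // f1 f2; exact: derivableM.
Qed.

Lemma derivable_bigsum (I : Type) (r : seq I) (P : pred I) (f : I -> K -> K) t :
  (forall i, derivable (f i) t (1 : K)) ->
  derivable (fun s => \sum_(i <- r | P i) f i s) t (1 : K).
Proof.
move=> dft; apply: ex_derive; apply: is_derive_bigsum => i.
exact: derivable_is_derive1.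
Qed.

Lemma derivable_det n (F : K -> 'M[K]_n) t :
  (forall i j, derivable (fun s => F s i j : K) t (1 : K)) ->
  derivable (fun s => \det (F s) : K) t (1 : K).
Proof.
move=> dFt; apply: derivable_bigsum => s; apply: derivableM.
  exact: derivable_cst.
by apply: derivable_bigprod => i; exact: dFt.
Qed.

(** Cramer's formula, valid near [t], shows that the inverse is differentiable;
    its derivative then comes from differentiating [F F^-1 = 1]. *)
Lemma mx_is_derive_inv n (F : K -> 'M[K]_n) t dF :
  (\near t, F t \in unitmx) -> mx_is_derive F t dF ->
  mx_is_derive (fun s => invmx (F s)) t (- (invmx (F t) *m dF *m invmx (F t))).
Proof.
move=> Fu dFt; have Ftu : F t \in unitmx by exact: nbhs_singleton Fu.
have dF1 i j : derivable (fun s => F s i j : K) t (1 : K).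
  exact: ex_derive.
have dV : mx_is_derive (fun s => invmx (F s)) t (mx_derive1 (fun s => invmx (F s)) t).
  move=> i j; rewrite mxE; apply: derivable_is_derive1.
  apply: (@near_eq_derivable _ _ _
    (fun s => (\det (F s))^-1 * cofactor (F s) j i : K)).
    by apply: filterS Fu => s Fsu; rewrite /invmx Fsu !mxE.
  apply: derivableM.
    apply: derivableV; last exact: derivable_det.
    by move: Ftu; rewrite unitmxE unitfE.
  apply: derivableM; first exact: derivable_cst.
  apply: derivable_det => i' j'.
  under eq_fun do rewrite !mxE.
  exact: dF1.
have : mx_is_derive (fun=> 1%:M) t (dF *m invmx (F t) +
    F t *m mx_derive1 (fun s => invmx (F s)) t).
  apply: mx_is_derive_near (mx_is_deriveM dFt dV).
  by apply: filterS Fu => s Fsu; rewrite mulmxV.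
move=> /mx_is_derive_derive1; rewrite (mx_is_derive_derive1 (mx_is_derive_cst _ _)).
move=> /esym /(congr1 (mulmx (invmx (F t)))).
rewrite mulmx0 mulmxDr !mulmxA mulVmx// mul1mx => /eqP.
by rewrite addrC addr_eq0 => /eqP <-.
Qed.

End MatrixCalculus.

(** * Identities between words in noncommuting matrices *)
Section NoncommutativeNormalization.
Variable K : comNzRingType.

Lemma addmxE m n (A B : 'M[K]_(m, n)) i j : (A + B) i j = A i j + B i j.
Proof. by rewrite mxE. Qed.

Lemma oppmxE m n (A : 'M[K]_(m, n)) i j : (- A) i j = - A i j.
Proof. by rewrite mxE. Qed.

Lemma scalemxE m n a (A : 'M[K]_(m, n)) i j : (a *: A) i j = a * A i j.
Proof. by rewrite mxE. Qed.

Lemma zeromxE m n i j : (0 : 'M[K]_(m, n)) i j = 0.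
Proof. by rewrite mxE. Qed.

Lemma scalarmxE n a i j : (a%:M : 'M[K]_n) i j = a * (i == j)%:R.
Proof. by rewrite mxE mulr_natr. Qed.

Lemma mulmxZl m n p a (A : 'M[K]_(m, n)) (B : 'M[K]_(n, p)) :
  (a *: A) *m B = a *: (A *m B).
Proof. by rewrite scalemxAl. Qed.

Lemma mulmxZr m n p a (A : 'M[K]_(m, n)) (B : 'M[K]_(n, p)) :
  A *m (a *: B) = a *: (A *m B).
Proof. by rewrite scalemxAr. Qed.

Definition commmx n (A B : 'M[K]_n) : 'M[K]_n := A *m B - B *m A.

End NoncommutativeNormalization.

Ltac ncexpand :=
  repeat (progress (rewrite ?(mulmx0, mul0mx, mulmx1, mul1mx);
    rewrite ?(mul_scalar_mx, mul_mx_scalar);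
    rewrite ?(mulmxZl, mulmxZr); rewrite ?(mulmxN, mulNmx);
    rewrite ?(mulmxDl, mulmxDr); rewrite ?mulmxA)).

(** Normalizes both sides to combinations of words in the matrices, then compares
    entries, a word being an indeterminate. *)
Ltac ncentries :=
  ncexpand; apply/matrixP => ? ?;
  repeat (progress (rewrite ?addmxE; rewrite ?oppmxE;
    rewrite ?scalemxE; rewrite ?zeromxE; rewrite ?scalarmxE)).

(** * Compatibility as equations for the coefficients of the poles *)
Section Residues.
Variable K : numFieldType.

(** The three values at x = -1, 2, 3 already determine the coefficients. *)
Lemma partial_fractions_eq0 n (E0 E2 E1 : 'M[K]_n) :
  (forall x : K, x != 0 -> x != 1 ->
     x^-1 *: E0 + ((x - 1) ^+ 2)^-1 *: E2 + (x - 1)^-1 *: E1 = 0) ->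
  [/\ E0 = 0, E2 = 0 & E1 = 0].
Proof.
move=> E; suff Eij i j : [/\ E0 i j = 0, E2 i j = 0 & E1 i j = 0].
  by split; apply/matrixP => i j; have [] := Eij i j; rewrite mxE.
have n2 : (2 : K) != 0 by rewrite pnatr_eq0.
have n3 : (3 : K) != 0 by rewrite pnatr_eq0.
have N1 : (-1 : K) != 1.
  by rewrite -subr_eq0 -opprD oppr_eq0 -[1 + 1]/(2%:R) pnatr_eq0.
have := E 2; have := E 3; have := E (-1).
rewrite -![_ == 1]subr_eq0.
have -> : 2 - 1 = 1 :> K by ring.
have -> : 3 - 1 = 2 :> K by ring.
have -> : -1 - 1 = - 2 :> K by ring.
rewrite !oppr_eq0 oner_eq0 n2 n3.
move=> /(_ isT isT)/matrixP/(_ i j) + /(_ isT isT)/matrixP/(_ i j) +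
  /(_ isT isT)/matrixP/(_ i j).
rewrite !(addmxE, scalemxE, zeromxE) => e1 e2 e3.
(* With a, b, c the three entries, the equations are - a + b/4 - c/2 = 0,
   a/3 + b/4 + c/2 = 0 and a/2 + b + c = 0; the combination below is a. *)
have a0 : E0 i j = 0.
  transitivity (2 * ((2^-1 * E0 i j + (1 ^+ 2)^-1 * E2 i j + 1^-1 * E1 i j)
    - 3 * (3^-1 * E0 i j + (2 ^+ 2)^-1 * E2 i j + 2^-1 * E1 i j)
    - ((-1)^-1 * E0 i j + ((- 2) ^+ 2)^-1 * E2 i j + (- 2)^-1 * E1 i j))).
    by field; rewrite ?n2 ?n3.
  by rewrite e1 e2 e3 mulr0 !subr0 mulr0.
move: e2 e3; rewrite a0 !mulr0 !add0r expr1n invr1 !mul1r => e2 /eqP.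
rewrite addr_eq0 => /eqP b0; move: e2; rewrite b0 => e2.
have c0 : E1 i j = 0.
  transitivity (4 * ((2 ^+ 2)^-1 * - E1 i j + 2^-1 * E1 i j)).
    by field; rewrite ?n2 ?n3.
  by rewrite e2 mulr0.
by rewrite c0 oppr0.
Qed.

(** The left-hand side of the compatibility condition is the conjugate by [G] of a
    combination of [x^-1], [(x - 1)^-2] and [(x - 1)^-1]: the product of poles in the
    commutator splits by [1 / (x (x - 1)) = 1 / (x - 1) - 1 / x], and the commutator
    of [A2] with itself, the only term of order 3, vanishes. *)
Lemma compatible_residues n (G A0 A2 A1 : K -> 'M[K]_n) t dG dA0 dA2 dA1 :
  t != 0 -> (\near t, G t \in unitmx) ->
  mx_is_derive G t dG -> mx_is_derive A0 t dA0 ->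
  mx_is_derive A2 t dA2 -> mx_is_derive A1 t dA1 ->
  let A s x := invmx (G s) *m
    (x^-1 *: A0 s + ((x - 1) ^+ 2)^-1 *: A2 s + (x - 1)^-1 *: A1 s) *m G s in
  let B s x := - (s * (x - 1))^-1 *: (invmx (G s) *m A2 s *m G s) in
  let C := dG *m invmx (G t) in
  (forall x, x != 0 -> x != 1 -> compatible_at A B t x) <->
  [/\ dA0 + commmx (A0 t) C + t^-1 *: commmx (A0 t) (A2 t) = 0,
      dA2 - t^-1 *: A2 t + commmx (A2 t) C - t^-1 *: commmx (A1 t) (A2 t) = 0 &
      dA1 + commmx (A1 t) C - t^-1 *: commmx (A0 t) (A2 t) = 0].
Proof.
move=> t0 Gu dGt dA0t dA2t dA1t A B C.
have Gtu : G t \in unitmx by exact: nbhs_singleton Gu.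
have dGE : dG = C *m G t by rewrite /C mulmxKV.
set E0 := dA0 + _ + _; set E2 := dA2 - _ + _ - _; set E1 := dA1 + _ - _.
pose E x := x^-1 *: E0 + ((x - 1) ^+ 2)^-1 *: E2 + (x - 1)^-1 *: E1.
have key x : x != 0 -> x != 1 ->
    mx_derive1 (A^~ x) t - mx_derive1 (B t) x + (A t x *m B t x - B t x *m A t x)
    = invmx (G t) *m E x *m G t.
  move=> x0 x1; have x10 : x - 1 != 0 by rewrite subr_eq0.
  have dcst (a : K) : is_derive t (1 : K) (fun=> a) 0 by exact: is_derive_cst.
  have dA := mx_is_deriveM (mx_is_deriveM (mx_is_derive_inv Gu dGt)
    (mx_is_deriveD (mx_is_deriveD (mx_is_deriveZ (dcst x^-1) dA0t)
      (mx_is_deriveZ (dcst ((x - 1) ^+ 2)^-1) dA2t))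
      (mx_is_deriveZ (dcst (x - 1)^-1) dA1t))) dGt.
  rewrite (mx_is_derive_derive1 dA) {dA}.
  have db : is_derive x (1 : K) (fun y => - (t * (y - 1))^-1 : K)
      (t^-1 * ((x - 1) ^+ 2)^-1).
    have dl := is_deriveM (is_derive_cst t x (1 : K))
      (is_deriveB (is_derive_id x (1 : K)) (is_derive_cst (1 : K) x (1 : K))).
    apply: is_derive_ext (is_deriveN (is_derive_inv dl _)) _ _ => //=.
      by rewrite mulf_neq0.
    rewrite /= !scaler0 addr0 subr0 /GRing.scale /=.
    rewrite -[X in X ^+ 2]/(t * (x - 1)).
    by field; rewrite x10 t0.
  rewrite (mx_is_derive_derive1 (mx_is_deriveZ db (mx_is_derive_cst _ _))).
  rewrite /A /B !scale0r !add0r scaler0 addr0 dGE.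
  rewrite /E /E0 /E2 /E1 /commmx; ncexpand.
  rewrite !(mulmxK Gtu) !(mulmxKV Gtu).
  ncentries; field.
  by rewrite x0 x10 t0.
split=> [comp|[e0 e2 e1] x x0 x1]; last first.
  by rewrite /compatible_at key// /E e0 e2 e1 !scaler0 !addr0 mulmx0 mul0mx.
apply: partial_fractions_eq0 => x x0 x1.
have := comp x x0 x1; rewrite /compatible_at key// -/(E x).
move=> /(congr1 (fun X => G t *m X *m invmx (G t))).
by rewrite !mulmxA mulmxV// mul1mx mulmxK// mulmx0 mul0mx.
Qed.

End Residues.

(** * The matrix equations for P, Q, Z *)

(** In this section [P] stands for [Pmx] plus [t], [a] and [b] for theta^0 and
    theta^oo_1, [T] for Theta, and [C1], [C2] for the diagonal blocks of G' G^-1. *)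
Section BlockEquations.
Variables (K : numFieldType) (n : nat) (a b t : K).
Variables (T P Q Z dP dQ dZ C1 C2 : 'M[K]_n).
Hypothesis t0 : t != 0.

Definition coef0 := col_mx 1%:M (- Z) *m row_mx (a%:M - P *m Z) (- P).

Definition coef1_2 :=
  col_mx 1%:M (Q - Z) *m row_mx (- (t *: (1%:M - Q)) - t *: Z) (- t%:M).

Definition coef1_1 :=
  block_mx (- (a + b)%:M + P *m Z) P
           (a *: Z - Z *m P *m Z) (- (Z *m P) - T).

(** The derivatives of [coef0] and [coef1_2] when [P], [Q], [Z] have derivatives [dP],
    [dQ], [dZ] and [t] is the variable. *)
Definition dcoef0 :=
  col_mx 0 (- dZ) *m row_mx (a%:M - P *m Z) (- P) +
  col_mx 1%:M (- Z) *m row_mx (- (dP *m Z + P *m dZ)) (- dP).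

Definition dcoef1_2 :=
  col_mx 0 (dQ - dZ) *m row_mx (- (t *: (1%:M - Q)) - t *: Z) (- t%:M) +
  col_mx 1%:M (Q - Z) *m
    row_mx (t *: dQ - (1%:M - Q) - Z - t *: dZ) (- 1%:M).

Definition gauge_defect := t *: (C1 - C2) - (P - Q *m P - P *m Q + (a + b)%:M - T).

Definition P_defect :=
  dP - (C1 *m P - P *m C2 + P *m Q + Q *m P - P - a%:M).

Definition Q_defect := t *: dQ -
  (t *: (Q - Q *m Q) + (a + b) *: Q - T *m Q - Q *m P *m Q
   - (b *: Z - T *m Z) + t *: (C2 *m Q - Q *m C1)).

Definition Z_defect := dZ - (Q - Q *m Q + C2 *m Z - Z *m C1).

Let C := block_mx C1 0 0 C2.

(** Reduces a Lax equation for a product [B D], with a linear term [c B D], to equations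
    for the factors. The matrix [N] is free, because [B D] is unchanged when [B] and
    [D] are replaced by [B g] and [g^-1 D]. *)
Lemma factor_flow m k (X : 'M[K]_m) (N : 'M[K]_k) (c : K)
    (B dB : 'M[K]_(m, k)) (D dD : 'M[K]_(k, m)) :
  dB *m D + B *m dD - c *: (B *m D) - commmx X (B *m D) =
  (dB - X *m B - B *m N) *m D + B *m (dD - c *: D + D *m X + N *m D).
Proof. by rewrite /commmx; ncentries; ring. Qed.

(** The term [N] is fixed by requiring that the upper block of the column factor,
    which is constant, gives no equation; its lower block then gives the equation for
    [Z], and the second block of the row factor the one for [P]. *)
Lemma residue_at_0 :
  dcoef0 + commmx coef0 C + t^-1 *: commmx coef0 coef1_2 =
  block_mx (- (P_defect *m Z) - P *m Z_defect) (- P_defect)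
    (- (Z_defect *m (a%:M - P *m Z)) + Z *m (P_defect *m Z + P *m Z_defect))
    (Z_defect *m P + Z *m P_defect).
Proof.
pose X := C + t^-1 *: coef1_2; pose N := 1%:M - C1 - Q.
transitivity (dcoef0 - 0 *: coef0 - commmx X coef0).
  (* The coefficients are generalized so that they are not expanded. *)
  rewrite /X /commmx; move: dcoef0 coef0 coef1_2 => ? ? ?.
  by ncentries; ring.
have XE : X = block_mx (C1 - 1%:M + Q - Z) (- 1%:M)
    (- ((Q - Z) *m (1%:M - Q + Z))) (C2 - Q + Z).
  rewrite /X /coef1_2 mul_col_row scale_block_mx add_block_mx.
  by congr block_mx; ncentries; field; exact: t0.
rewrite /dcoef0 /coef0 (factor_flow _ N).
have -> : col_mx 0 (- dZ) - X *m col_mx 1%:M (- Z) - col_mx 1%:M (- Z) *m N =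
    col_mx 0 (- Z_defect).
  rewrite XE mul_block_col mul_col_mx !opp_col_mx !add_col_mx /Z_defect /N.
  by congr col_mx; ncentries; ring.
have -> : row_mx (- (dP *m Z + P *m dZ)) (- dP)
    - 0 *: row_mx (a%:M - P *m Z) (- P)
    + row_mx (a%:M - P *m Z) (- P) *m X + N *m row_mx (a%:M - P *m Z) (- P)
    = row_mx (- (P_defect *m Z) - P *m Z_defect) (- P_defect).
  rewrite XE mul_row_block mul_mx_row scale_row_mx opp_row_mx !add_row_mx.
  by rewrite /Z_defect /P_defect /N; congr row_mx; ncentries; ring.
rewrite !mul_col_row add_block_mx; move: P_defect Z_defect => r s.
by congr block_mx; ncentries; ring.
Qed.

(** Same method. The lower block of the column factor gives the equation for [Q - Z],
    and the second block of the row factor, which is the scalar [- t], gives the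
    algebraic constraint on [C1 - C2]. *)
Lemma residue_at_1 :
  dcoef1_2 - t^-1 *: coef1_2 + commmx coef1_2 C - t^-1 *: commmx coef1_1 coef1_2 =
  block_mx (Q_defect - t *: Z_defect + gauge_defect *m (Z - Q)) gauge_defect
    (- ((Q_defect - t *: Z_defect) *m (1%:M - Q + Z))
     + (Q - Z) *m (Q_defect - t *: Z_defect + gauge_defect *m (Z - Q)))
    (- (Q_defect - t *: Z_defect) + (Q - Z) *m gauge_defect).
Proof.
pose X := C + t^-1 *: coef1_1; pose N := t^-1 *: ((a + b)%:M - P *m Q) - C1.
transitivity (dcoef1_2 - t^-1 *: coef1_2 - commmx X coef1_2).
  rewrite /X /commmx; move: dcoef1_2 coef1_1 coef1_2 => ? ? ?.
  by ncentries; ring.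
have XE : X = block_mx (C1 + t^-1 *: (P *m Z - (a + b)%:M)) (t^-1 *: P)
    (t^-1 *: (a *: Z - Z *m P *m Z)) (C2 - t^-1 *: (Z *m P + T)).
  rewrite /X /coef1_1 scale_block_mx add_block_mx.
  by congr block_mx; ncentries; ring.
rewrite /dcoef1_2 /coef1_2 (factor_flow _ N).
have -> : col_mx 0 (dQ - dZ) - X *m col_mx 1%:M (Q - Z)
    - col_mx 1%:M (Q - Z) *m N = col_mx 0 (t^-1 *: (Q_defect - t *: Z_defect)).
  rewrite XE mul_block_col mul_col_mx !opp_col_mx !add_col_mx /Q_defect /Z_defect /N.
  by congr col_mx; ncentries; field; exact: t0.
set D := row_mx (- (t *: (1%:M - Q)) - t *: Z) _.
have -> : row_mx (t *: dQ - (1%:M - Q) - Z - t *: dZ) (- 1%:M)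
    - t^-1 *: D + D *m X + N *m D
    = row_mx (Q_defect - t *: Z_defect + gauge_defect *m (Z - Q)) gauge_defect.
  rewrite XE /D mul_row_block mul_mx_row scale_row_mx opp_row_mx !add_row_mx.
  rewrite /Q_defect /Z_defect /gauge_defect /N.
  by congr row_mx; ncentries; field; rewrite t0.
rewrite /D !mul_col_row add_block_mx.
move: (Q_defect - t *: Z_defect) gauge_defect => r g.
by congr block_mx; ncentries; field; rewrite ?t0.
Qed.

(** The residue at infinity is constant and block diagonal. *)
Lemma coef1_1E : coef1_1 = - (coef0 + block_mx b%:M 0 0 T).
Proof.
rewrite /coef1_1 /coef0 mul_col_row add_block_mx opp_block_mx.
congr block_mx; ncentries; ring.
Qed.

(** The upper right blocks give the vanishing of [P_defect] and [gauge_defect]. What is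
    left at 0 contains [Z_defect P = 0] and [Z_defect (a - P Z) = 0], from which
    [a Z_defect = 0]. *)
Lemma residue_equations : a != 0 -> commmx T C2 = 0 ->
  [/\ dcoef0 + commmx coef0 C + t^-1 *: commmx coef0 coef1_2 = 0,
      dcoef1_2 - t^-1 *: coef1_2 + commmx coef1_2 C
        - t^-1 *: commmx coef1_1 coef1_2 = 0 &
      - dcoef0 + commmx coef1_1 C - t^-1 *: commmx coef0 coef1_2 = 0] <->
  [/\ gauge_defect = 0, P_defect = 0, Q_defect = 0 & Z_defect = 0].
Proof.
move=> a0 TC2; rewrite residue_at_1 residue_at_0.
have -> : - dcoef0 + commmx coef1_1 C - t^-1 *: commmx coef0 coef1_2 =
    - (dcoef0 + commmx coef0 C + t^-1 *: commmx coef0 coef1_2)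
    - commmx (block_mx b%:M 0 0 T) C.
  rewrite coef1_1E /commmx; move: dcoef0 coef0 coef1_2 => ? ? ?.
  by ncentries; ring.
have -> : commmx (block_mx b%:M 0 0 T) C = 0.
  rewrite /commmx /C !mulmx_block opp_block_mx add_block_mx.
  rewrite !(mulmx0, mul0mx, addr0, add0r, oppr0) -/(commmx T C2) TC2.
  by rewrite mul_scalar_mx mul_mx_scalar subrr block_mx0.
rewrite subr0 residue_at_0; split=> [[e0 e2 _]|[rG rP rQ rZ]]; last first.
  rewrite rG rP rQ rZ.
  by rewrite !(mulmx0, mul0mx, addr0, add0r, oppr0, scaler0) block_mx0 oppr0.
have z4 : (0 : 'M[K]_(n + n)) = block_mx 0 0 0 0 by rewrite block_mx0.
rewrite z4 in e0 e2.
have [eul /eqP + edl edr] := eq_block_mx e0; rewrite oppr_eq0 => /eqP rP.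
have [+ rG _ _] := eq_block_mx e2.
rewrite rG mul0mx addr0 => rQZ.
move: eul edl edr; rewrite rP !(mulmx0, mul0mx, addr0, add0r, oppr0).
move=> /eqP; rewrite oppr_eq0 => /eqP PrZ.
rewrite PrZ mulmx0 addr0 => + rZP.
rewrite mulmxBr mulmxA rZP mul0mx subr0 mul_mx_scalar => /eqP.
rewrite oppr_eq0 scaler_eq0 (negPf a0) => /eqP rZ.
by move: rQZ; rewrite rZ scaler0 subr0.
Qed.

End BlockEquations.

(** * Explicit 2 x 2 matrices *)
Section TwoByTwo.
Variable K : numFieldType.

Lemma mx2_eta (A : 'M[K]_2) : A = mx2 (A 0 0) (A 0 1) (A 1 0) (A 1 1).
Proof.
by apply/matrixP => -[[|[|//]] ?] [[|[|//]] ?]; rewrite !mxE /=;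
   congr (A _ _); apply/val_inj.
Qed.

Lemma mx2_inj (a b c d a' b' c' d' : K) :
  mx2 a b c d = mx2 a' b' c' d' -> [/\ a = a', b = b', c = c' & d = d'].
Proof.
by move/matrixP => E; have := (E 0 0, E 0 1, E 1 0, E 1 1); rewrite !mxE => -[[[]]].
Qed.

Lemma mx2D (a b c d a' b' c' d' : K) :
  mx2 a b c d + mx2 a' b' c' d' = mx2 (a + a') (b + b') (c + c') (d + d').
Proof. by rewrite [LHS]mx2_eta !mxE. Qed.

Lemma mx2N (a b c d : K) : - mx2 a b c d = mx2 (- a) (- b) (- c) (- d).
Proof. by rewrite [LHS]mx2_eta !mxE. Qed.

Lemma mx2Z (k a b c d : K) : k *: mx2 a b c d = mx2 (k * a) (k * b) (k * c) (k * d).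
Proof. by rewrite [LHS]mx2_eta !mxE. Qed.

Lemma mx2M (a b c d a' b' c' d' : K) :
  mx2 a b c d *m mx2 a' b' c' d' =
  mx2 (a * a' + b * c') (a * b' + b * d') (c * a' + d * c') (c * b' + d * d').
Proof. by rewrite [LHS]mx2_eta !mxE !big_ord_recl !big_ord0 !mxE /= !addr0. Qed.

Lemma mx2_scalar (a : K) : a%:M = mx2 a 0 0 a.
Proof. by rewrite [LHS]mx2_eta !mxE. Qed.

Lemma mx2_0 : 0 = mx2 0 0 0 0 :> 'M[K]_2.
Proof. by rewrite [LHS]mx2_eta !mxE. Qed.

Lemma mx2_tr (a b c d : K) : \tr (mx2 a b c d) = a + d.
Proof. by rewrite /mxtrace !big_ord_recl big_ord0 !mxE /= addr0. Qed.

Lemma unitmx_mx2_diag (a d : K) : a != 0 -> d != 0 -> mx2 a 0 0 d \in unitmx.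
Proof.
move=> a0 d0; suff E : mx2 a 0 0 d *m mx2 a^-1 0 0 d^-1 = 1%:M.
  by have [] := mulmx1_unit E.
by rewrite mx2M mx2_scalar !mulfV// !(mulr0, mul0r, addr0, add0r).
Qed.

(** The Hamiltonian is a polynomial of degree at most 2 in each of the variables q_1,
    p_1, q_2, p_2 separately, so this covers all its partial derivatives. *)
Lemma quadratic_derive1 (f : K -> K) (a b x : K) :
  (forall y, f y = a * y ^+ 2 + b * y + f 0) -> derive1 f x = 2 * a * x + b.
Proof.
move=> fE; apply: is_derive_derive1.
have did := is_derive_id x (1 : K).
have dq := is_deriveD (is_deriveD
  (is_deriveM (is_derive_cst a x (1 : K)) (is_deriveM did did))
  (is_deriveM (is_derive_cst b x (1 : K)) did)) (is_derive_cst (f 0) x (1 : K)).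
apply: is_derive_ext dq _ _ => [y|]; first by rewrite [f y]fE expr2.
rewrite -[LHS]/(a * (x * 1 + x * 1) + x * x * 0 + (b * 1 + x * 0) + 0).
ring.
Qed.

End TwoByTwo.

(** Rewrites an expression in explicit 2 x 2 matrices as one such matrix. *)
Ltac mx2norm :=
  rewrite ?mx2_scalar;
  repeat (progress (rewrite ?mx2Z; rewrite ?mx2N; rewrite ?mx2M; rewrite ?mx2D)).

(** * The Hamiltonian in scalar form *)
Section Hamiltonian.
Variables (K : numFieldType) (th : exponents K) (q1 p1 q2 p2 t : K).

Let e := th0 th + th1 th + thi1 th.
Let c := 2 * th0 th + th1 th + 2 * thi1 th.
Let r := p2 * q2 - e - thi2 th.
Let s := q1 ^+ 2 - q1 - q2.
Let h := p1 ^+ 2 / 4 + t * p1 / 2 - p2 * r.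

(** Here [r] is the lower left entry of [Pmx], [s] is half the trace of Q (Q - 1) and
    [h] half the trace of P (P + t). *)
Definition t_dHdp1 := (p1 + t) * s + (2 * q1 - 1) * (p2 * q2 + r) + e - c * q1.
Definition t_dHdq1 := 2 * h * (2 * q1 - 1) + 2 * (p1 + t) * (p2 * q2 + r)
  - 2 * (th0 th + th1 th + 2 * thi1 th - 1) * t - c * p1.
Definition t_dHdp2 := - 2 * (r + p2 * q2) * s + 2 * q2 * (p1 + t) * (2 * q1 - 1)
  - 2 * c * q2.
Definition t_dHdq2 := - 2 * p2 ^+ 2 * s - 2 * h + 2 * p2 * (p1 + t) * (2 * q1 - 1)
  - 2 * c * p2.

Lemma HamE : Ham th q1 p1 q2 p2 t =
  t^-1 * (2 * h * s + (p1 + t) * (2 * q1 - 1) * (p2 * q2 + r) + e * p1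
    - 2 * (th0 th + th1 th + 2 * thi1 th - 1) * t * q1
    - c * (p1 * q1 + p2 * q2 + r)).
Proof.
rewrite /Ham /Pmx /Qmx; mx2norm; rewrite mx2_tr; congr (_ * _).
by rewrite /h /s /r /c /e; field; rewrite ?pnatr_eq0.
Qed.

End Hamiltonian.

Section HamiltonianDerivatives.
Variables (K : numFieldType) (th : exponents K) (q1 p1 q2 p2 t : K).

Let e := th0 th + th1 th + thi1 th.
Let c := 2 * th0 th + th1 th + 2 * thi1 th.
Let f := e + thi2 th.
Let g := 2 * p2 * q2 - f.
Let s := q1 ^+ 2 - q1 - q2.

Lemma derive_Ham_p1 :
  derive1 (fun y => Ham th q1 y q2 p2 t) p1 = t^-1 * t_dHdp1 th q1 p1 q2 p2 t.
Proof.
rewrite (@quadratic_derive1 _ _ (t^-1 * (s / 2))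
  (t^-1 * (t * s + (2 * q1 - 1) * g + e - c * q1))) => [|y].
  by rewrite /t_dHdp1 /s /g /f /e /c; move: t^-1 => u; field; rewrite ?pnatr_eq0.
by rewrite !HamE /s /g /f /e /c; move: t^-1 => u; field; rewrite ?pnatr_eq0.
Qed.

Lemma derive_Ham_q1 :
  derive1 (fun y => Ham th y p1 q2 p2 t) q1 = t^-1 * t_dHdq1 th q1 p1 q2 p2 t.
Proof.
pose h := p1 ^+ 2 / 4 + t * p1 / 2 - p2 * (p2 * q2 - f).
rewrite (@quadratic_derive1 _ _ (t^-1 * (2 * h))
  (t^-1 * (- 2 * h + 2 * (p1 + t) * g
     - 2 * (th0 th + th1 th + 2 * thi1 th - 1) * t - c * p1))) => [|y].
  by rewrite /t_dHdq1 /h /g /f /e /c; ring.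
by rewrite !HamE /h /g /f /e /c; ring.
Qed.

Lemma derive_Ham_p2 :
  derive1 (fun y => Ham th q1 p1 q2 y t) p2 = t^-1 * t_dHdp2 th q1 p1 q2 p2 t.
Proof.
rewrite (@quadratic_derive1 _ _ (t^-1 * (- 2 * q2 * s))
  (t^-1 * (2 * f * s + 2 * q2 * (p1 + t) * (2 * q1 - 1) - 2 * c * q2))) => [|y].
  by rewrite /t_dHdp2 /s /f /e /c; ring.
by rewrite !HamE /s /f /e /c; ring.
Qed.

Lemma derive_Ham_q2 :
  derive1 (fun y => Ham th q1 p1 y p2 t) q2 = t^-1 * t_dHdq2 th q1 p1 q2 p2 t.
Proof.
rewrite (@quadratic_derive1 _ _ (t^-1 * (2 * p2 ^+ 2))
  (t^-1 * (- 2 * p2 ^+ 2 * (q1 ^+ 2 - q1) - (p1 ^+ 2 / 2 + t * p1 + 2 * p2 * f)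
     + 2 * p2 * (p1 + t) * (2 * q1 - 1) - 2 * c * p2))) => [|y].
  by rewrite /t_dHdq2 /f /e /c; move: t^-1 => u; field; rewrite ?pnatr_eq0.
by rewrite !HamE /f /e /c; move: t^-1 => u; field; rewrite ?pnatr_eq0.
Qed.

End HamiltonianDerivatives.

(** * The matrix equations in scalar form *)
Section ScalarEquations.
Variables (K : numFieldType) (th : exponents K).
Hypothesis th_sum :
  2 * th0 th + 2 * th1 th + 2 * thi1 th + thi2 th + thi3 th = 0.
Hypothesis thi12 : thi1 th != thi2 th.
Hypothesis thi13 : thi1 th != thi3 th.
Variables (q1 p1 q2 p2 t dq1 dp1 dq2 dp2 w : K) (C1 : 'M[K]_2).
Hypothesis t0 : t != 0.

Let T := Thetamx th.
Let Q := Qmx q1 q2.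
Let P := Pmx th p1 q2 p2 + t%:M.
Let Z := Zmx th q1 p1 q2 p2 t.
Let C2 := mx2 w 0 0 0.
Let a := th0 th.
Let b := thi1 th.
Let e := th0 th + th1 th + thi1 th.
Let c := 2 * th0 th + th1 th + 2 * thi1 th.
(* The inverse of the prefactor of [Zmx]; multiplying by it makes the identities
   polynomial. *)
Let T1 := b%:M - T.

Definition dQmx := mx2 dq1 0 (- dq2) dq1.
(** The identity is the derivative of the summand [t] of [P]. *)
Definition dPmx := mx2 (dp1 / 2) (- dp2) (dp2 * q2 + p2 * dq2) (dp1 / 2) + 1%:M.

Definition dZmx := invmx T1 *m
  (- (dPmx *m Q *m (Q - 1%:M) + P *m dQmx *m (Q - 1%:M) + P *m Q *m dQmx)
   + c *: dQmx).

(* [HQ] and [HP] are the variations of [Qmx] and [Pmx] in the direction (hq1, hp1,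
   hq2, hp2). *)
Let hq1 := t * dq1 - t_dHdp1 th q1 p1 q2 p2 t.
Let hp1 := t * dp1 + t_dHdq1 th q1 p1 q2 p2 t.
Let hq2 := t * dq2 - t_dHdp2 th q1 p1 q2 p2 t.
Let hp2 := t * dp2 + t_dHdq2 th q1 p1 q2 p2 t.
Let HQ := mx2 hq1 0 (- hq2) hq1.
Let HP := mx2 (hp1 / 2) (- hp2) (hp2 * q2 + p2 * hq2) (hp1 / 2).
Let H1 := t *: C1 - Mmx th q1 p1 q2 p2 t.
Let H2 := mx2 (t * w - vrate th q1 p1 q2 p2 t) 0 0 0.

Let thi3E : thi3 th = - (2 * th0 th + 2 * th1 th + 2 * thi1 th + thi2 th).
Proof. by apply/eqP; rewrite -addr_eq0 addrC th_sum. Qed.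

Let T1unit : T1 \in unitmx.
Proof.
rewrite /T1 /T /Thetamx mx2_scalar mx2N mx2D oppr0 addr0.
by apply: unitmx_mx2_diag; rewrite subr_eq0.
Qed.

Lemma T1Z : T1 *m Z = - (P *m Q *m (Q - 1%:M)) + c *: Q - e%:M.
Proof. by rewrite /Z /Zmx /= mulKVmx. Qed.

(** The solutions of the scalar system satisfy the matrix equation exactly, and the
    rest is linear in the derivatives; the same holds for the next three lemmas. *)
Lemma gauge_defect_linear : gauge_defect a b t T P Q C1 C2 = H1 - H2.
Proof.
rewrite /gauge_defect /T /P /Q /Thetamx /Qmx /Pmx /H1 /H2 /C2 /Mmx /vrate /a /b.
rewrite thi3E (mx2_eta C1); mx2norm.
by congr mx2; field; rewrite ?pnatr_eq0.
Qed.

Lemma P_defect_linear : t *: P_defect a P Q dPmx C1 C2 = HP - H1 *m P + P *m H2.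
Proof.
rewrite /P_defect /P /Q /Qmx /Pmx /HP /H1 /H2 /C2 /Mmx /vrate /a /dPmx.
rewrite thi3E (mx2_eta C1); mx2norm.
by congr mx2; rewrite /hp1 /hp2 /hq2 /t_dHdq1 /t_dHdq2 /t_dHdp2; field;
  rewrite ?pnatr_eq0.
Qed.

Lemma Q_defect_linear : Q_defect a b t T P Q Z dQmx C1 C2 = HQ + Q *m H1 - H2 *m Q.
Proof.
have T1Z' : b *: Z - T *m Z = T1 *m Z by rewrite mulmxBl mul_scalar_mx.
rewrite /Q_defect T1Z' T1Z /T /P /Q /Thetamx /Qmx /Pmx /HQ /H1 /H2 /C2 /Mmx.
rewrite /vrate /a /b /dQmx.
rewrite thi3E (mx2_eta C1); mx2norm.
by congr mx2; rewrite /hq1 /hq2 /t_dHdp1 /t_dHdp2 /e /c; field; rewrite ?pnatr_eq0.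
Qed.

Lemma T1_Z_defect_linear :
  t *: (T1 *m Z_defect Q Z dZmx C1 C2) =
  - (HP *m Q *m (Q - 1%:M) + P *m HQ *m (Q - 1%:M) + P *m Q *m HQ) + c *: HQ
  - H2 *m (T1 *m Z) + T1 *m Z *m H1.
Proof.
have T1C2 : T1 *m C2 = C2 *m T1.
  by rewrite /T1 /T /Thetamx /C2; mx2norm; congr mx2; ring.
have -> : T1 *m Z_defect Q Z dZmx C1 C2 = T1 *m dZmx
    - (T1 *m (Q - Q *m Q) + C2 *m (T1 *m Z) - T1 *m Z *m C1).
  by rewrite /Z_defect mulmxBr 2!mulmxDr mulmxN !mulmxA T1C2.
rewrite T1Z /dZmx mulKVmx//.
rewrite /T1 /T /P /Q /Thetamx /Qmx /Pmx /HQ /HP /H1 /H2 /C2 /Mmx /vrate /a /b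
  /dQmx /dPmx.
rewrite thi3E (mx2_eta C1); mx2norm.
by congr mx2;
  rewrite /hq1 /hq2 /hp1 /hp2 /t_dHdp1 /t_dHdp2 /t_dHdq1 /t_dHdq2 /e /c; field;
  rewrite ?pnatr_eq0.
Qed.

(** The vanishing of the first three defects forces [H1 = H2 = diag(w, 0)] and then
    [HQ = H2 Q - Q H2], whose upper right entry is [w] on the right and 0 on the left
    since that entry of [Qmx] is 1. *)
Lemma scalar_equations :
  [/\ gauge_defect a b t T P Q C1 C2 = 0, P_defect a P Q dPmx C1 C2 = 0,
      Q_defect a b t T P Q Z dQmx C1 C2 = 0 & Z_defect Q Z dZmx C1 C2 = 0] <->
  [/\ [/\ dq1 = t^-1 * t_dHdp1 th q1 p1 q2 p2 t,
          dp1 = - (t^-1 * t_dHdq1 th q1 p1 q2 p2 t),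
          dq2 = t^-1 * t_dHdp2 th q1 p1 q2 p2 t &
          dp2 = - (t^-1 * t_dHdq2 th q1 p1 q2 p2 t)],
      t *: C1 = Mmx th q1 p1 q2 p2 t & t * w = vrate th q1 p1 q2 p2 t].
Proof.
have tE x y : (t * x - y = 0) <-> (x = t^-1 * y).
  split=> [/eqP|->]; last by rewrite mulVKf// subrr.
  by rewrite subr_eq0 => /eqP <-; rewrite mulKf.
have tE' x y : (t * x + y = 0) <-> (x = - (t^-1 * y)).
  by rewrite -mulrN -tE opprK.
split=> [[eG eP eQ _]|[[/tE eq1 /tE' ep1 /tE eq2 /tE' ep2] eC ew]]; last first.
  have HQ0 : HQ = 0 by rewrite /HQ /hq1 /hq2 eq1 eq2 oppr0 -mx2_0.
  have HP0 : HP = 0.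
    by rewrite /HP /hp1 /hp2 /hq2 ep1 ep2 eq2 oppr0 mul0r mulr0 addr0 mul0r -mx2_0.
  have H10 : H1 = 0 by rewrite /H1 eC subrr.
  have H20 : H2 = 0 by rewrite /H2 ew subrr -mx2_0.
  have E := (HQ0, HP0, H10, H20, mulmx0, mul0mx, addr0, add0r, oppr0, subr0, scaler0).
  have T1inj X : t *: (T1 *m X) = 0 -> X = 0.
    move/eqP; rewrite scaler_eq0 (negPf t0) => /eqP/(congr1 (mulmx (invmx T1))).
    by rewrite mulKmx// mulmx0.
  split; first by rewrite gauge_defect_linear !E.
  - by apply: (scalerI t0); rewrite P_defect_linear !E.
  - by rewrite Q_defect_linear !E.
  - by apply: T1inj; rewrite T1_Z_defect_linear !E.
have H12 : H1 = H2 by apply/eqP; rewrite -subr_eq0 -gauge_defect_linear eG.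
have := Q_defect_linear; rewrite eQ H12 /HQ /H2 /Q /Qmx; mx2norm; rewrite mx2_0.
case/mx2_inj => _ ew _ _.
have {}ew : t * w - vrate th q1 p1 q2 p2 t = 0.
  by apply/eqP; rewrite -oppr_eq0; apply/eqP; rewrite [RHS]ew; ring.
have H20 : H2 = 0 by rewrite /H2 ew -mx2_0.
have := Q_defect_linear; rewrite eQ H12 H20 mulmx0 mul0mx addr0 subr0 /HQ mx2_0.
case/mx2_inj => /esym eq1 _ /esym/eqP; rewrite oppr_eq0 => /eqP eq2 _.
have := P_defect_linear; rewrite eP scaler0 H12 H20 mulmx0 mul0mx addr0 subr0 /HP mx2_0.
case/mx2_inj => /esym/eqP; rewrite mulf_eq0 invr_eq0 pnatr_eq0 orbF => /eqP ep1.
move=> /esym/eqP; rewrite oppr_eq0 => /eqP ep2 _ _.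
split; first by split; [apply/tE|apply/tE'|apply/tE|apply/tE'].
  by apply/eqP; rewrite -subr_eq0 -/H1 H12 H20.
by apply/eqP; rewrite -subr_eq0 ew.
Qed.

End ScalarEquations.

(** * The system along functions of t *)
Section Differentiation.
Variable K : numFieldType.

Lemma mx_is_derive_mx2 (f g h k : K -> K) t df dg dh dk :
  is_derive t (1 : K) f df -> is_derive t (1 : K) g dg ->
  is_derive t (1 : K) h dh -> is_derive t (1 : K) k dk ->
  mx_is_derive (fun s => mx2 (f s) (g s) (h s) (k s)) t (mx2 df dg dh dk).
Proof.
move=> dft dgt dht dkt i j; rewrite mxE.
have -> : (fun s => mx2 (f s) (g s) (h s) (k s) i j) =
    (if i == 0 then (if j == 0 then f else g) else (if j == 0 then h else k)).
  by apply/funext => s; rewrite mxE; case: (i == 0); case: (j == 0).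
by case: (i == 0); case: (j == 0).
Qed.

Lemma mx_is_derive_scalar n t :
  mx_is_derive (fun s => s%:M : 'M[K]_n) t 1%:M.
Proof.
have dt := mx_is_deriveZ (is_derive_id t (1 : K)) (mx_is_derive_cst (1%:M : 'M[K]_n) t).
rewrite (_ : (fun s : K => s%:M) = (fun s => s *: (1%:M : 'M[K]_n))).
  by apply: mx_is_derive_ext dt _; rewrite scale1r scaler0 addr0.
by apply/funext => s; rewrite scalemx1.
Qed.

Section Blocks.
Variables (n : nat) (a b t : K) (T dP dQ dZ : 'M[K]_n) (P Q Z : K -> 'M[K]_n).
Hypothesis dPt : mx_is_derive P t dP.
Hypothesis dQt : mx_is_derive Q t dQ.
Hypothesis dZt : mx_is_derive Z t dZ.

Lemma mx_is_derive_coef0 :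
  mx_is_derive (fun s => coef0 a (P s) (Z s)) t (dcoef0 a (P t) (Z t) dP dZ).
Proof.
apply: mx_is_deriveM.
  apply: mx_is_derive_col; first exact: mx_is_derive_cst.
  exact: mx_is_deriveN.
apply: mx_is_derive_row; last exact: mx_is_deriveN.
apply: mx_is_derive_ext (mx_is_deriveD (mx_is_derive_cst _ _)
  (mx_is_deriveN (mx_is_deriveM dPt dZt))) _.
by rewrite add0r.
Qed.

(** The residues at 0 and 1 have a constant sum, hence opposite derivatives. *)
Lemma mx_is_derive_coef1_1 :
  mx_is_derive (fun s => coef1_1 a b T (P s) (Z s)) t (- dcoef0 a (P t) (Z t) dP dZ).
Proof.
have -> : (fun s => coef1_1 a b T (P s) (Z s)) =
    (fun s => - (coef0 a (P s) (Z s) + block_mx b%:M 0 0 T)).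
  by apply/funext => s; rewrite coef1_1E.
apply: mx_is_derive_ext (mx_is_deriveN (mx_is_deriveD mx_is_derive_coef0
  (mx_is_derive_cst _ _))) _.
by rewrite addr0.
Qed.

Lemma mx_is_derive_coef1_2 :
  mx_is_derive (fun s => coef1_2 s (Q s) (Z s)) t (dcoef1_2 t (Q t) (Z t) dQ dZ).
Proof.
have did := is_derive_id t (1 : K).
apply: mx_is_deriveM.
  apply: mx_is_derive_col; first exact: mx_is_derive_cst.
  exact: mx_is_deriveD dQt (mx_is_deriveN dZt).
apply: mx_is_derive_row; last exact: mx_is_deriveN (mx_is_derive_scalar _).
apply: mx_is_derive_ext (mx_is_deriveD (mx_is_deriveN (mx_is_deriveZ did
  (mx_is_deriveD (mx_is_derive_cst _ _) (mx_is_deriveN dQt))))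
  (mx_is_deriveN (mx_is_deriveZ did dZt))) _.
by rewrite !scale1r; ncentries; ring.
Qed.

End Blocks.
End Differentiation.

Section Pointwise.
Variables (K : numFieldType) (th : exponents K).
Hypothesis th_sum :
  2 * th0 th + 2 * th1 th + 2 * thi1 th + thi2 th + thi3 th = 0.
Hypothesis th0_neq0 : th0 th != 0.
Hypothesis thi12 : thi1 th != thi2 th.
Hypothesis thi13 : thi1 th != thi3 th.
Variables (q1 p1 q2 p2 v : K -> K) (U : K -> 'M[K]_2) (t : K).
Hypothesis t0 : t != 0.
Hypothesis dq1 : derivable q1 t (1 : K).
Hypothesis dp1 : derivable p1 t (1 : K).
Hypothesis dq2 : derivable q2 t (1 : K).
Hypothesis dp2 : derivable p2 t (1 : K).
Hypothesis dv : derivable v t (1 : K).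
Hypothesis dU : forall i j, derivable (fun s => U s i j : K) t (1 : K).
Hypothesis v0 : \near t, v t != 0.
Hypothesis U0 : \near t, \det (U t) != 0.

Let dQ := dQmx (derive1 q1 t) (derive1 q2 t).
Let dP := dPmx (q2 t) (p2 t) (derive1 p1 t) (derive1 q2 t) (derive1 p2 t).
Let dZ := dZmx th (q1 t) (p1 t) (q2 t) (p2 t) t
  (derive1 q1 t) (derive1 p1 t) (derive1 q2 t) (derive1 p2 t).

Lemma mx_is_derive_Qmx : mx_is_derive (fun s => Qmx (q1 s) (q2 s)) t dQ.
Proof.
exact: mx_is_derive_mx2 (derivable_is_derive1 dq1)
  (is_derive_cst (1 : K) t (1 : K)) (is_deriveN (derivable_is_derive1 dq2))
  (derivable_is_derive1 dq1).
Qed.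

Lemma mx_is_derive_Pmx :
  mx_is_derive (fun s => Pmx th (p1 s) (q2 s) (p2 s) + s%:M) t dP.
Proof.
have dp1' : is_derive t (1 : K) (fun s => p1 s / 2 : K) (derive1 p1 t / 2).
  have dp1t := is_deriveM (is_derive_cst (2^-1 : K) t (1 : K))
    (derivable_is_derive1 dp1).
  apply: is_derive_ext dp1t _ _ => [s|]; first exact: mulrC.
  by rewrite scaler0 addr0; exact: mulrC.
have dpq := is_deriveM (derivable_is_derive1 dp2) (derivable_is_derive1 dq2).
have dr := is_deriveB dpq
  (is_derive_cst (th0 th + th1 th + thi1 th + thi2 th) t (1 : K)).
apply: mx_is_deriveD; last exact: mx_is_derive_scalar.
apply: (mx_is_derive_mx2 dp1' (is_deriveN (derivable_is_derive1 dp2)) _ dp1').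
apply: is_derive_ext dr _ _ => [s|].
  by rewrite -[LHS]/(p2 s * q2 s - (th0 th + th1 th + thi1 th + thi2 th)); ring.
rewrite -[LHS]/(p2 t * derive1 q2 t + q2 t * derive1 p2 t - 0); ring.
Qed.

Lemma mx_is_derive_Zmx :
  mx_is_derive (fun s => Zmx th (q1 s) (p1 s) (q2 s) (p2 s) s) t dZ.
Proof.
have [dQt dPt] := (mx_is_derive_Qmx, mx_is_derive_Pmx).
have dcst (a : K) : is_derive t (1 : K) (fun=> a) 0 by exact: is_derive_cst.
have dmcst m n (A : 'M[K]_(m, n)) := mx_is_derive_cst A t.
apply: mx_is_derive_ext (mx_is_deriveM (dmcst _ _ _)
  (mx_is_deriveD (mx_is_deriveD (mx_is_deriveN (mx_is_deriveM
    (mx_is_deriveM dPt dQt) (mx_is_deriveD dQt (dmcst _ _ (- 1%:M)))))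
    (mx_is_deriveZ (dcst _) dQt)) (dmcst _ _ (- _)))) _.
by rewrite mul0mx add0r /dZ /dZmx !addr0 scale0r add0r mulmxDl.
Qed.

Let G s := Gmx (U s) (v s).
Let dG := block_mx (mx_derive1 U t) 0 0 (mx2 (derive1 v t) 0 0 0).

Lemma mx_is_derive_Gmx : mx_is_derive G t dG.
Proof.
apply: mx_is_derive_block; try exact: mx_is_derive_cst.
  by move=> i j; rewrite mxE; exact: derivable_is_derive1 (@dU i j).
by apply: mx_is_derive_mx2; try exact: is_derive_cst; exact: derivable_is_derive1.
Qed.

Lemma Gmx_unit : \near t, G t \in unitmx.
Proof.
apply: filterS2 v0 U0 => s vs Us.
rewrite unitmxE /G /Gmx det_ublock unitrM -!unitmxE unitmxE unitfE Us.
by apply: unitmx_mx2_diag => //; rewrite oner_eq0.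
Qed.

Lemma log_derive_Gmx : dG *m invmx (G t) =
  block_mx (mx_derive1 U t *m invmx (U t)) 0 0 (mx2 (derive1 v t / v t) 0 0 0).
Proof.
have Gu : G t \in unitmx by exact: nbhs_singleton Gmx_unit.
have Uu : U t \in unitmx by rewrite unitmxE unitfE; exact: nbhs_singleton U0.
have vt : v t != 0 by exact: nbhs_singleton v0.
apply: (can_inj (mulmxK Gu)); rewrite mulmxKV//.
rewrite /G /Gmx mulmx_block !(mulmx0, mul0mx, addr0, add0r) mulmxKV// mx2M.
by rewrite !(mulr0, mul0r, addr0) divfK.
Qed.

(** The equations hold at each point separately: the derivatives at [t] of the unknown
    functions enter only through their values. *)
Lemma compatible_at_equations :
  (forall x, x != 0 -> x != 1 -> compatible_at
     (fun s x => Amx th (q1 s) (p1 s) (q2 s) (p2 s) (v s) (U s) s x)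
     (fun s x => Bmx th (q1 s) (p1 s) (q2 s) (p2 s) (v s) (U s) s x) t x) <->
  [/\ hamiltonian_system th q1 p1 q2 p2 t, U_equation th q1 p1 q2 p2 U t &
      v_equation th q1 p1 q2 p2 v t].
Proof.
pose P s := Pmx th (p1 s) (q2 s) (p2 s) + s%:M.
pose Q s := Qmx (q1 s) (q2 s).
pose Z s := Zmx th (q1 s) (p1 s) (q2 s) (p2 s) s.
have [[dQt dPt] dZt] := (mx_is_derive_Qmx, mx_is_derive_Pmx, mx_is_derive_Zmx).
have hatA0E : (fun s => hatA00 th (q1 s) (p1 s) (q2 s) (p2 s) s) =
    (fun s => coef0 (th0 th) (P s) (Z s)).
  by apply/funext => s; rewrite /hatA00 /coef0 /P opprD [- _ - s%:M]addrC.
have dA0 := mx_is_derive_coef0 (th0 th) dPt dZt.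
rewrite -hatA0E in dA0.
have compat := compatible_residues t0 Gmx_unit mx_is_derive_Gmx dA0
  (mx_is_derive_coef1_2 dQt dZt)
  (mx_is_derive_coef1_1 (th0 th) (thi1 th) (Thetamx th) dPt dZt).
rewrite log_derive_Gmx (congr1 (@^~ t) hatA0E) /= in compat.
apply: (iff_trans compat).
set C1 := mx_derive1 U t *m _; set w := derive1 v t / v t.
have TC2 : commmx (Thetamx th) (mx2 w 0 0 0) = 0.
  by rewrite /commmx /Thetamx; mx2norm; rewrite mx2_0; congr mx2; ring.
apply: (iff_trans (residue_equations _ _ _ _ _ _ _ _ t0 th0_neq0 TC2)).
apply: (iff_trans (scalar_equations th_sum thi12 thi13 _ _ _ _ _ _ _ _ _ _ t0)).
rewrite /hamiltonian_system /U_equation /v_equation.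
rewrite derive_Ham_p1 derive_Ham_q1 derive_Ham_p2 derive_Ham_q2.
have Uu : U t \in unitmx by rewrite unitmxE unitfE; exact: nbhs_singleton U0.
have UE : (t *: C1 = Mmx th (q1 t) (p1 t) (q2 t) (p2 t) t) <->
    (t *: mx_derive1 U t = Mmx th (q1 t) (p1 t) (q2 t) (p2 t) t *m U t).
  split=> [<-|E]; first by rewrite -scalemxAl mulmxKV.
  by rewrite /C1 scalemxAl E mulmxK.
have -> : t / v t * derive1 v t = t * w by rewrite /w; ring.
by split=> -[E1 E2 E3]; split=> //; apply/UE.
Qed.

End Pointwise.

Lemma compatible_on_open (K : numFieldType) (th : exponents K) (D : set K)
    (q1 p1 q2 p2 v : K -> K) (U : K -> 'M[K]_2) :
  2 * th0 th + 2 * th1 th + 2 * thi1 th + thi2 th + thi3 th = 0 ->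
  th0 th != 0 -> thi1 th != thi2 th -> thi1 th != thi3 th ->
  open D -> ~ D 0 ->
  holomorphic_on D q1 -> holomorphic_on D p1 ->
  holomorphic_on D q2 -> holomorphic_on D p2 ->
  holomorphic_on D v -> mx_holomorphic_on D U ->
  (forall t, D t -> v t != 0) -> (forall t, D t -> \det (U t) != 0) ->
  (forall t, D t -> forall x, x != 0 -> x != 1 -> compatible_at
     (fun s x => Amx th (q1 s) (p1 s) (q2 s) (p2 s) (v s) (U s) s x)
     (fun s x => Bmx th (q1 s) (p1 s) (q2 s) (p2 s) (v s) (U s) s x) t x) <->
  (forall t, D t ->
    [/\ hamiltonian_system th q1 p1 q2 p2 t, U_equation th q1 p1 q2 p2 U t &
        v_equation th q1 p1 q2 p2 v t]).
Proof.
move=> th_sum th00 thi12 thi13 Dopen D0 q1h p1h q2h p2h vh Uh v0 U0.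
suff E t : D t ->
    (forall x, x != 0 -> x != 1 -> compatible_at
       (fun s x => Amx th (q1 s) (p1 s) (q2 s) (p2 s) (v s) (U s) s x)
       (fun s x => Bmx th (q1 s) (p1 s) (q2 s) (p2 s) (v s) (U s) s x) t x) <->
    [/\ hamiltonian_system th q1 p1 q2 p2 t, U_equation th q1 p1 q2 p2 U t &
        v_equation th q1 p1 q2 p2 v t].
  by split=> H t Dt; [apply/(E t Dt)/H|apply/(E t Dt); exact: H].
move=> Dt; have nD : nbhs t D by exact: open_nbhs_nbhs.
apply: compatible_at_equations => //.
- by apply/eqP => t0; apply: D0; rewrite -t0.
- exact: q1h.
- exact: p1h.
- exact: q2h.
- exact: p2h.
- exact: vh.
- by move=> i j; exact: Uh.
- by apply: filterS nD => s /v0.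
- by apply: filterS nD => s /U0.
Qed.

Unset Implicit Arguments.
Set Strict Implicit.

Theorem mainTheorem5 (R : realType) (th : exponents R[i]) (D : set R[i])
    (q1 p1 q2 p2 v : R[i] -> R[i]) (U : R[i] -> 'M[R[i]]_2)
    (th_sum : 2 * th0 th + 2 * th1 th + 2 * thi1 th + thi2 th + thi3 th = 0)
    (th0_neq0 : th0 th != 0)
    (thi12 : thi1 th != thi2 th) (thi13 : thi1 th != thi3 th)
    (thi23 : thi2 th != thi3 th)
    (D_domain : is_domain D) (D0 : ~ D 0)
    (q1_hol : holomorphic_on D q1) (p1_hol : holomorphic_on D p1)
    (q2_hol : holomorphic_on D q2) (p2_hol : holomorphic_on D p2)
    (v_hol : holomorphic_on D v) (U_hol : mx_holomorphic_on D U)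
    (v_neq0 : forall t, D t -> v t != 0)
    (U_inv : forall t, D t -> \det (U t) != 0) :
  let A (t x : R[i]) := Amx th (q1 t) (p1 t) (q2 t) (p2 t) (v t) (U t) t x in
  let B (t x : R[i]) := Bmx th (q1 t) (p1 t) (q2 t) (p2 t) (v t) (U t) t x in
  (forall t, D t -> forall x : R[i], x != 0 -> x != 1 -> compatible_at A B t x)
  <->
  (forall t, D t ->
    [/\ hamiltonian_system th q1 p1 q2 p2 t,
        U_equation th q1 p1 q2 p2 U t &
        v_equation th q1 p1 q2 p2 v t]).
Proof.
by move=> A B; apply: compatible_on_open => //; case: D_domain.
Qed.
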